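(* Suppose that an $\mathrm{OLH}(n,m)$ exists, where $n$ is a multiple of $4$ such that a Hadamard matrix of order $n$ exists. Then: (i) the following orthogonal Latin hypercubes all exist (can be constructed): an $\mathrm{OLH}(2n,m)$, an $\mathrm{OLH}(4n,2m)$, an $\mathrm{OLH}(8n,4m)$ and an $\mathrm{OLH}(16n,8m)$; (ii) the following orthogonal Latin hypercubes also all exist (can be constructed): an $\mathrm{OLH}(2n+1,m)$, an $\mathrm{OLH}(4n+1,2m)$, an $\mathrm{OLH}(8n+1,4m)$ and an $\mathrm{OLH}(16n+1,8m)$.
   Context: A Latin hypercube of $n\ge 2$ runs with $m$ factors is an $n\times m$ matrix each of whose columns is a permutation of the $n$ levels $-(n-1)/2,-(n-3)/2,\ldots,(n-3)/2,(n-1)/2$. It is called orthogonal if $x_i^Tx_j=0$ for every two distinct columns $x_i,x_j$. $\mathrm{OLH}(n,m)$ denotes an orthogonal Latin hypercube of $n$ runs with $m$ factors. A Hadamard matrix of order $n$ is an $n\times n$ matrix with entries $\pm1$ whose columns are mutually orthogonal. *)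

(* Defs.v *)
From HB Require Import structures.
From mathcomp Require Import all_boot all_order all_algebra perm.
Set Implicit Arguments.
Unset Strict Implicit.
Unset Printing Implicit Defensive.
Import Order.TTheory GRing.Theory Num.Theory.
Local Open Scope ring_scope.

(* The levels are integers or half-integers, so designs have entries in rat. *)
Definition level (n : nat) (k : 'I_n) : rat := - ((n%:R - 1) / 2%:R) + k%:R.

Definition orthogonal_columns (n m : nat) (X : 'M[rat]_(n, m)) : Prop :=
  forall i j : 'I_m, i != j -> (col i X)^T *m col j X = 0.

Definition latin_hypercube (n m : nat) (L : 'M[rat]_(n, m)) : Prop :=
  forall j : 'I_m, exists s : 'S_n, forall i : 'I_n, L i j = level (s i).

Definition OLH (n m : nat) (L : 'M[rat]_(n, m)) : Prop :=
  latin_hypercube L /\ orthogonal_columns L.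

Definition OLH_exists (n m : nat) : Prop := exists L : 'M[rat]_(n, m), OLH L.

Definition hadamard (n : nat) (H : 'M[rat]_n) : Prop :=
  (forall i j : 'I_n, H i j = 1 \/ H i j = -1) /\ orthogonal_columns H.

(* Main.v *)
Require Import Defs.
From HB Require Import structures.
From mathcomp Require Import all_boot all_order all_algebra perm.
From mathcomp Require Import zify ring.
Set Implicit Arguments.
Unset Strict Implicit.
Unset Printing Implicit Defensive.
Import Order.TTheory GRing.Theory Num.Theory.
Local Open Scope ring_scope.

(** Let [B] be an OLH(n,m) and [D] a +-1 matrix of the same size with
    orthogonal columns (m columns of a Hadamard matrix; [m <= n] because the
    columns of [B] are orthogonal and nonzero). For k = 1, 2, 4, 8, the real
    numbers, complex numbers, quaternions and octonions give an orthogonal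
    design of order k: a matrix with entries [s a p * w (a + p)], a and p in
    (Z/2)^r, whose columns are orthogonal whatever the k values of [w]. The
    matrix with entries
      [s a p * (B i j + (-1)^u * w (a + p) * D i j)],
    rows (u,a,i) and columns (p,j), then has orthogonal columns: the cross
    terms cancel in the sum over u, and the rest factors into inner products
    of columns of [s], [s * w], [B] and [D]. With [w] running over
    (n(2q+1) + e)/2, 0 <= q < k, each column splits into 2k translates
    of +-(a column of [B]), which tile the levels of 2kn + e runs, with the
    level 0 left over for an additional zero row when e = 1. *)

Lemma orthogonal_columnsP (n m : nat) (X : 'M[rat]_(n, m)) :
  orthogonal_columns X <->
  (forall i j : 'I_m, i != j -> \sum_r X r i * X r j = 0).
Proof.
have E i j : ((col i X)^T *m col j X) 0 0 = \sum_r X r i * X r j.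
  by rewrite !mxE; apply: eq_bigr => r _; rewrite !mxE.
split=> HX i j ij; first by rewrite -E HX // mxE.
by apply/matrixP=> a b; rewrite !ord1 E HX // mxE.
Qed.

(** Structured finite types can then index rows and columns: an injective numbering of [R] by
    naturals below [#|R|] is a permutation. *)
Lemma OLH_exists_of_family (R C : finType) (N M : nat)
    (f : R -> C -> rat) (t : R -> C -> nat) :
  #|R| = N -> #|C| = M ->
  (forall r c, t r c < N)%N ->
  (forall c, injective (t^~ c)) ->
  (forall r c, f r c = - ((N%:R - 1) / 2%:R) + (t r c)%:R) ->
  (forall c d, c != d -> \sum_r f r c * f r d = 0) ->
  OLH_exists N M.
Proof.
move=> <- <- t_lt t_inj fE f_orth.
exists (\matrix_(i, j) f (enum_val i) (enum_val j)); split=> [j|].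
  pose g (i : 'I_#|R|) := Ordinal (t_lt (enum_val i) (enum_val j)).
  have g_inj : injective g.
    by move=> x y /(congr1 val) /= /t_inj /enum_val_inj.
  by exists (perm g_inj) => i; rewrite mxE permE fE.
apply/orthogonal_columnsP=> i j ij.
rewrite -[RHS](f_orth (enum_val i) (enum_val j)) ?(inj_eq enum_val_inj) //.
rewrite [RHS](reindex (@enum_val R predT)) /=; last first.
  by apply: onW_bij; apply: enum_val_bij.
by apply: eq_bigr => r _; rewrite !mxE.
Qed.

Lemma OLH_factors_le_runs (n m : nat) (L : 'M[rat]_(n, m)) :
  (2 <= n)%N -> OLH L -> (m <= n)%N.
Proof.
move=> n2 [latL /orthogonal_columnsP orthL].
have norm_neq0 j : \sum_i L i j * L i j != 0.
  have [s sE] := latL j.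
  (* Level number 0 is [-(n-1)/2], nonzero because [n >= 2]. *)
  have [i0 Li0] : exists i0, L i0 j != 0.
    exists ((s^-1)%g (Ordinal (ltnW n2))); rewrite sE permKV /level /= addr0.
    by rewrite oppr_eq0 mulf_neq0 // subr_eq0 pnatr_eq1 neq_ltn n2 orbT.
  rewrite psumr_eq0 => [|i _]; last by rewrite -expr2 sqr_ge0.
  by apply/allPn; exists i0; rewrite ?mem_index_enum //= mulf_neq0.
have gram : L^T *m L = diag_mx (\row_j \sum_i L i j * L i j).
  apply/matrixP=> i j; rewrite !mxE; under eq_bigr do rewrite !mxE.
  by have [->|ij] := eqVneq i j; rewrite ?mulr1n // mulr0n orthL.
have rank_gram : \rank (L^T *m L) = m.
  apply: mxrank_unit; rewrite unitmxE gram det_diag unitfE.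
  by apply/prodf_neq0 => j _; rewrite mxE.
by rewrite -[m in (m <= _)%N]rank_gram (leq_trans (mxrankM_maxr _ _)) ?rank_leq_row.
Qed.

Lemma level_rev_ord (n : nat) (x : 'I_n) : level (rev_ord x) = - level x.
Proof.
by rewrite /level /= natrB // -[x.+1]addn1 natrD; field.
Qed.

(* The levels of 2kn + e runs, numbered from 0 in increasing order, are cut into
   2k consecutive blocks of length n, with a gap in the middle if e = 1. The
   block centred at -(n(2q+1) + e)/2 (if [neg]) or +(n(2q+1) + e)/2 (if not)
   has the number [block_number k neg q]. *)
Definition block_number (k : nat) (neg : bool) (q : nat) : nat :=
  if neg then (k - q.+1)%N else (k + q)%N.

Definition cell_index (n k : nat) (e neg : bool) (q x : nat) : nat :=
  (x + block_number k neg q * n + (e && ~~ neg))%N.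

Lemma cell_index_inj (n k : nat) (e neg neg' : bool) (q q' x x' : nat) :
  (q < k)%N -> (q' < k)%N -> (x < n)%N -> (x' < n)%N ->
  cell_index n k e neg q x = cell_index n k e neg' q' x' ->
  [/\ neg = neg', q = q' & x = x'].
Proof.
rewrite /cell_index /block_number => qk qk' xn xn'.
case: neg; case: neg'; rewrite ?andbT ?andbF ?addn0 => E.
- suff: (k - q.+1 = k - q'.+1)%N by move=> F; split=> //; nia.
  nia.
- nia.
- nia.
- suff: (q = q')%N by move=> F; split=> //; nia.
  nia.
Qed.

Lemma cell_index_lt (n k : nat) (e neg : bool) (q x : nat) :
  (q < k)%N -> (x < n)%N -> (cell_index n k e neg q x < 2 * k * n + e)%N.
Proof.
rewrite /cell_index /block_number => qk xn; case: neg; case: e => /=; nia.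
Qed.

Lemma cell_index_neq_mid (n k : nat) (neg : bool) (q x : nat) :
  (q < k)%N -> (x < n)%N -> cell_index n k true neg q x <> (k * n)%N.
Proof.
rewrite /cell_index /block_number => qk xn; case: neg => /=; nia.
Qed.

Lemma cell_index_level (n k : nat) (e neg : bool) (q : nat) (x : 'I_n) :
  (q < k)%N ->
  level x + (-1) ^+ neg * ((n%:R * (2 * q%:R + 1) + e%:R) / 2) =
  - (((2 * k * n + e)%:R - 1) / 2%:R) + (cell_index n k e neg q x)%:R.
Proof.
move=> qk; rewrite /cell_index /block_number /level.
case: neg; rewrite ?andbT ?andbF /= ?addn0 ?expr1 ?expr0 !natrD !natrM.
  by rewrite (natrB _ qk) -[q.+1]addn1 natrD; field.
by rewrite natrD; field.
Qed.

(* [op] plays the role of addition in (Z/2)^r; in the third condition the rows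
   [a] and [a + p + q] of the columns [p] and [q] contain the same two
   variables, and the signs must make their contributions cancel. *)
Definition hurwitz_signing (G : finType) (op : G -> G -> G)
    (s : G -> G -> bool) : Prop :=
  [/\ forall a p, op (op a p) p = a,
      forall a p q, op (op a p) q = op (op a q) p
    & forall a p q, p != q ->
        s a p (+) s a q (+) s (op (op a p) q) p (+) s (op (op a p) q) q].

Lemma hurwitz_signing_orth (G : finType) (op : G -> G -> G)
    (s : G -> G -> bool) (w : G -> rat) (p q : G) :
  hurwitz_signing op s -> p != q ->
  \sum_a ((-1) ^+ s a p * w (op a p)) * ((-1) ^+ s a q * w (op a q)) = 0.
Proof.
case=> opK opAC s_odd pq; set S := (LHS).
(* Adding [p + q] to [a] is an involution that exchanges the two variables and flips the sign of
   each term. *)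
suff : S = - S by move/eqP; rewrite -addr_eq0 -mulr2n mulrn_eq0 => /eqP.
have tauK : involutive (fun a => op (op a p) q).
  by move=> a /=; rewrite [op _ p]opAC opK opK.
rewrite {1}/S (reindex_inj (inv_inj tauK)) /= -sumrN; apply: eq_bigr => a _.
rewrite opK [op (op (op a p) q) p]opAC opK.
have := s_odd a p q pq.
case: (s a p); case: (s a q); case: (s _ p); case: (s _ q) => //= _; ring.
Qed.

Lemma OLH_exists_hurwitz (G : finType) (op : G -> G -> G)
    (s : G -> G -> bool) (n m : nat) (e : bool)
    (B : 'M[rat]_(n, m)) (D : 'I_n -> 'I_m -> bool) :
  hurwitz_signing op s -> OLH B ->
  (forall j j', j != j' -> \sum_i (-1) ^+ D i j * (-1) ^+ D i j' = 0 :> rat) ->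
  OLH_exists (2 * #|G| * n + e) (#|G| * m).
Proof.
move=> sgn [latB /orthogonal_columnsP orthB] orthD.
have [opK opAC _] := sgn.
have /fin_all_exists [c cE] := latB.
have eT : 'I_e -> e = true by case: (e) => // -[].
(* The summand ['I_e] is the additional zero row: one element if [e] is true, none otherwise. *)
pose R : finType := ((bool * G * 'I_n) + 'I_e)%type.
pose C : finType := (G * 'I_m)%type.
pose q (a p : G) := enum_rank (op a p).
pose w (g : G) : rat := (n%:R * (2 * (enum_rank g)%:R + 1) + e%:R) / 2.
pose F (u : bool) (a : G) (i : 'I_n) (d : C) : rat :=
  (-1) ^+ s a d.1 * (B i d.2 + (-1) ^+ u * w (op a d.1) * (-1) ^+ D i d.2).
pose neg (u : bool) a i (d : C) := u (+) s a d.1 (+) D i d.2.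
(* A negative sign reverses the order of the levels in a column of [B]. *)
pose x (a : G) i (d : C) := if s a d.1 then rev_ord (c d.2 i) else c d.2 i.
pose f (r : R) (d : C) : rat :=
  if r is inl y then F y.1.1 y.1.2 y.2 d else 0.
pose t (r : R) (d : C) : nat :=
  if r is inl y then
    cell_index n #|G| e (neg y.1.1 y.1.2 y.2 d) (q y.1.2 d.1) (x y.1.2 y.2 d)
  else (#|G| * n)%N.
apply: (@OLH_exists_of_family R C _ _ f t).
- by rewrite card_sum !card_prod card_bool !card_ord.
- by rewrite card_prod card_ord.
- case=> [[[u a] i]|z] d /=; first exact: cell_index_lt.
  by rewrite (eT z) addn1 ltnS -mulnA leq_pmull.
- move=> [p j] [[[u a] i]|z] [[[u' a'] i']|z'] /=.
  (* For a fixed column, [q] determines [a], the place within the block then determines [i], and the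
     sign determines [u]. *)
  + move/cell_index_inj => [] // negE /ord_inj /enum_rank_inj qE xE.
    have aE : a = a' by rewrite -(opK a p) qE opK.
    move: negE xE; rewrite /neg /x /= {}aE => negE xE.
    have iE : i = i'.
      apply: (@perm_inj _ (c j)); move: xE.
      by case: ifP => _ /ord_inj // /rev_ord_inj.
    by move: negE; rewrite iE => /addIb /addIb ->.
  + move=> E; exfalso; move: E; rewrite (eT z').
    by apply: cell_index_neq_mid.
  + move=> /esym E; exfalso; move: E; rewrite (eT z).
    by apply: cell_index_neq_mid.
  + move=> _; congr inr; apply: val_inj.
    by move: (ltn_ord z) (ltn_ord z') (leq_b1 e) => /=; lia.
- case=> [[[u a] i]|z] d /=.
    rewrite -cell_index_level // /F cE /neg /x /w.
    by case: (s a d.1); case: u; case: (D i d.2);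
      rewrite /= ?level_rev_ord; ring.
  by rewrite (eT z) /= !natrD !natrM; field.
move=> [p j] [p' j'] neq; rewrite big_sumType /= [X in _ + X]big1 ?addr0; last first.
  by move=> z _; rewrite mul0r.
pose K u a i := F u a i (p, j) * F u a i (p', j').
rewrite -(pair_bigA _ (fun ua i => K ua.1 ua.2 i)) /=.
rewrite -(pair_bigA _ (fun u a => \sum_i K u a i)) /= big_bool -big_split /=.
pose S2 a := (-1) ^+ s a p * (-1) ^+ s a p' : rat.
under eq_bigr => a _.
  rewrite -big_split /=.
  under eq_bigr => i _.
    have -> : K true a i + K false a i =
      2 * S2 a * (B i j * B i j') +
      2 * ((-1) ^+ s a p * w (op a p) * ((-1) ^+ s a p' * w (op a p')))
        * ((-1) ^+ D i j * (-1) ^+ D i j').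
      by rewrite /K /F /S2 /=; ring.
    over.
  rewrite big_split /= -!mulr_sumr; over.
have [pp'|pp'] := eqVneq p p'.
  have jj' : j != j' by apply: contra neq => /eqP->; rewrite pp'.
  by rewrite big1 // => a _; rewrite orthB // orthD // !mulr0 addr0.
rewrite big_split /= -!mulr_suml -!mulr_sumr.
rewrite (hurwitz_signing_orth w sgn pp') mulr0 mul0r addr0.
(* Constant weights give the orthogonality of the columns of [s] itself. *)
have /= := hurwitz_signing_orth (fun=> 1) sgn pp'.
under eq_bigr do rewrite !mulr1.
by move=> ->; rewrite mulr0 mul0r.
Qed.

Definition xor2 (a b : bool * bool) := (a.1 (+) b.1, a.2 (+) b.2).
Definition xor3 (a b : bool * bool * bool) := (xor2 a.1 b.1, a.2 (+) b.2).

(* The octonions as a twisted group algebra of (Z/2)^3 (Albuquerque-Majid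
   cocycle): the basis vectors multiply by e_a e_b = +-e_(a+b), with this sign.
   Restricted to subgroups it gives the smaller division algebras. *)
Definition octonion_sign (a b : bool * bool * bool) : bool :=
  let: (x1, x2, x3) := a in let: (y1, y2, y3) := b in
  [&& x1 & y1] (+) [&& x1 & y2] (+) [&& x1 & y3] (+) [&& x2 & y2]
  (+) [&& x2 & y3] (+) [&& x3 & y3]
  (+) [&& y1, x2 & x3] (+) [&& x1, y2 & x3] (+) [&& x1, x2 & y3].

Lemma hurwitz_signing_octonion : hurwitz_signing xor3 octonion_sign.
Proof.
split.
- by case=> [[[] []] []] [[[] []] []].
- by case=> [[[] []] []] [[[] []] []] [[[] []] []].
- by case=> [[[] []] []] [[[] []] []] [[[] []] []].
Qed.

Lemma hurwitz_signing_sub (G : finType) (op : G -> G -> G)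
    (h : G -> bool * bool * bool) :
  injective h -> {morph h : a b / op a b >-> xor3 a b} ->
  hurwitz_signing op (fun a b => octonion_sign (h a) (h b)).
Proof.
move=> h_inj hM; have [opK opAC s_odd] := hurwitz_signing_octonion; split.
- by move=> a p; apply: h_inj; rewrite !hM opK.
- by move=> a p q; apply: h_inj; rewrite !hM opAC.
- by move=> a p q pq; rewrite !hM s_odd // (inj_eq h_inj).
Qed.

Theorem theorem3 (n m : nat) (hn : (2 <= n)%N)
  (hOLH : OLH_exists n m)
  (h4 : (4 %| n)%N)
  (hH : exists H : 'M[rat]_n, hadamard H) :
  [/\ OLH_exists (2 * n)%N m,
      OLH_exists (4 * n)%N (2 * m)%N,
      OLH_exists (8 * n)%N (4 * m)%N
    & OLH_exists (16 * n)%N (8 * m)%N]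
  /\
  [/\ OLH_exists (2 * n + 1)%N m,
      OLH_exists (4 * n + 1)%N (2 * m)%N,
      OLH_exists (8 * n + 1)%N (4 * m)%N
    & OLH_exists (16 * n + 1)%N (8 * m)%N].
Proof.
have [B olhB] := hOLH; have [H [H1 /orthogonal_columnsP orthH]] := hH.
have le_mn := OLH_factors_le_runs hn olhB.
(* The first [m] columns of [H], with -1 encoded as [true]. *)
pose D i (j : 'I_m) := H i (widen_ord le_mn j) == -1.
have DE i j : (-1) ^+ D i j = H i (widen_ord le_mn j).
  by rewrite /D; case: (H1 i (widen_ord le_mn j)) => ->.
have orthD j j' : j != j' ->
    \sum_i (-1) ^+ D i j * (-1) ^+ D i j' = 0 :> rat.
  by move=> jj'; under eq_bigr do rewrite !DE; apply: orthH.
have main (G : finType) op (h : G -> bool * bool * bool) (k : nat) (e : bool) :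
    #|G| = k -> injective h -> {morph h : a b / op a b >-> xor3 a b} ->
    OLH_exists (2 * k * n + e) (k * m).
  move=> <- h_inj hM.
  exact: (OLH_exists_hurwitz e (hurwitz_signing_sub h_inj hM) olhB orthD).
have case1 (e : bool) : OLH_exists (2 * n + e) m.
  have := main unit (fun _ _ => tt) (fun=> (false, false, false)) 1%N e.
  by rewrite muln1 mul1n; apply; [exact: card_unit | case=> -[] |].
have case2 (e : bool) : OLH_exists (4 * n + e) (2 * m).
  apply: (main bool addb (fun b => (false, false, b)) 2%N) => //.
    exact: card_bool.
  by move=> a b [].
have case4 (e : bool) : OLH_exists (8 * n + e) (4 * m).
  apply: (main (bool * bool)%type xor2 (fun b => (false, b.1, b.2)) 4%N).
  - by rewrite card_prod card_bool.
  - by move=> [? ?] [? ?] [] -> ->.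
  - by [].
have case8 (e : bool) : OLH_exists (16 * n + e) (8 * m).
  apply: (main (bool * bool * bool)%type xor3 id 8%N) => //.
  by rewrite !card_prod card_bool.
split; split; [rewrite -[(2 * n)%N]addn0 | rewrite -[(4 * n)%N]addn0
  | rewrite -[(8 * n)%N]addn0 | rewrite -[(16 * n)%N]addn0 | | | | ].
- exact: (case1 false).
- exact: (case2 false).
- exact: (case4 false).
- exact: (case8 false).
- exact: (case1 true).
- exact: (case2 true).
- exact: (case4 true).
- exact: (case8 true).
Qed.
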